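(* Let $\mathscr{G}_\infty$ be the class of simple graphs with infinite vertex set, and let $\leq_{im}$ denote the (strong) immersion relation. The quasi-order $(\mathscr{G}_\infty,\leq_{im})$ does not satisfy the finite intertwine property. That is, there exist graphs $G_1,G_2\in\mathscr{G}_\infty$ such that the class $\mathscr{I}_{\leq_{im}}(G_1,G_2)$ of all intertwines of $G_1$ and $G_2$ in $(\mathscr{G}_\infty,\leq_{im})$ contains an infinite antichain with respect to $\leq_{im}$.
   Context: A graph $G$ is a pair $(V(G),E(G))$ where $V(G)$ is an arbitrary, possibly infinite, set and $E(G)$ is a set of two-element subsets of $V(G)$ (so graphs are simple: no loops or multiple edges). $\mathscr{G}_\infty$ is the class of graphs whose vertex set is infinite. Immersion: let $\mathscr{P}(G)$ be the set of all nontrivial finite paths of $G$. A graph $H$ is immersed in $G$, written $H\leq_{im}G$, if there is a map $\varphi:V(H)\cup E(H)\to V(G)\cup\mathscr{P}(G)$ such that (1) if $v\in V(H)$ then $\varphi(v)\in V(G)$; (2) if $v\ne v'$ are vertices of $H$ then $\varphi(v)\neq\varphi(v')$; (3) if $e=\{v,v'\}\in E(H)$ then $\varphi(e)\in\mathscr{P}(G)$ is a path connecting $\varphi(v)$ with $\varphi(v')$; (4) if $e\neq e'$ are edges of $H$, the paths $\varphi(e)$ and $\varphi(e')$ are edge-disjoint; (5) if $e=\{v,v'\}\in E(H)$ and $v''$ is a vertex of $H$ other than $v,v'$, then $\varphi(v'')\notin V(\varphi(e))$. The relation $\leq_{im}$ is reflexive and transitive. Intertwines: for a quasi-order $(\mathscr{G},\leq)$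 (a reflexive and transitive relation on $\mathscr G$) and $G_1,G_2\in\mathscr{G}$, an intertwine of $G_1$ and $G_2$ is an element $G\in\mathscr{G}$ such that $G_1\leq G$ and $G_2\leq G$, and whenever $G'\in\mathscr{G}$ satisfies $G'\leq G$ and $G\not\leq G'$, then $G_1\not\leq G'$ or $G_2\not\leq G'$. The class of all intertwines of $G_1,G_2$ is denoted $\mathscr{I}_{\leq}(G_1,G_2)$. The quasi-order $(\mathscr{G},\leq)$ satisfies the finite intertwine property if for every $G_1,G_2\in\mathscr{G}$ the class $\mathscr{I}_{\leq}(G_1,G_2)$ has no infinite antichains, where an antichain is a set of elements such that $A\not\leq B$ for any two distinct members $A,B$. *)

(* Defs.v *)
From Stdlib Require List.
From mathcomp Require Import all_boot.
From mathcomp Require Import boolp classical_sets functions cardinality.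

Set Implicit Arguments.
Unset Strict Implicit.
Unset Printing Implicit Defensive.

Local Open Scope classical_set_scope.

Record graph := Graph {
  vertex : Type;
  edges : set (set vertex);
  edges_two_elements : forall e, edges e ->
    exists x y : vertex, x <> y /\ e = [set x; y]
}.

Arguments edges : clear implicits.

Definition infinite_graphs : set graph :=
  [set G | infinite_set [set: vertex G]].

(* A finite path is given by the sequence of the vertices it visits, hence
   comes with an orientation; the notions below do not depend on it. *)
Fixpoint path_edges (V : Type) (p : seq V) : set (set V) :=
  match p with
  | x :: ((y :: _) as q) => [set x; y] |` path_edges q
  | _ => set0
  end.

Definition path_vertices (V : Type) (p : seq V) : set V :=
  [set x | List.In x p].

Definition paths (G : graph) : set (seq (vertex G)) :=
  [set p | [/\ (1 < size p)%N, List.NoDup p & path_edges p `<=` edges G]].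

Arguments paths : clear implicits.

Definition connects (V : Type) (p : seq V) (x y : V) : Prop :=
  exists s : seq V, p = x :: rcons s y \/ p = y :: rcons s x.

(* The map on V(H) and E(H) is split into phiV and phiE; the values of phiE
   outside of E(H) are irrelevant. *)
Definition immersed (H G : graph) : Prop :=
  exists (phiV : vertex H -> vertex G)
         (phiE : set (vertex H) -> seq (vertex G)),
  [/\ forall v v', v <> v' -> phiV v <> phiV v',
      forall e, edges H e -> paths G (phiE e),
      forall v v', edges H [set v; v'] ->
        connects (phiE [set v; v']) (phiV v) (phiV v'),
      forall e e', edges H e -> edges H e' -> e <> e' ->
        path_edges (phiE e) `&` path_edges (phiE e') = set0
    & forall e v, edges H e -> ~ e v -> ~ path_vertices (phiE e) (phiV v)].

Definition intertwines (T : Type) (C : set T) (le : T -> T -> Prop)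
    (G1 G2 : T) : set T :=
  [set G | [/\ C G, le G1 G, le G2 G
    & forall G', C G' -> le G' G -> ~ le G G' -> ~ le G1 G' \/ ~ le G2 G']].

Definition antichain (T : Type) (le : T -> T -> Prop) (S : set T) : Prop :=
  forall A B, S A -> S B -> A <> B -> ~ le A B.

Definition finite_intertwine_property (T : Type) (C : set T)
    (le : T -> T -> Prop) : Prop :=
  forall G1 G2, C G1 -> C G2 ->
    ~ exists S : set T,
        [/\ S `<=` intertwines C le G1 G2, antichain le S & infinite_set S].

(* Main.v *)
Require Import Defs.
From Stdlib Require Import Inverse_Image Eqdep_dec PeanoNat.
From mathcomp Require Import all_boot.
From mathcomp Require Import boolp classical_sets functions cardinality wochoice.

(* A comb has a tip for every point of a set X of infinite binary sequences, and
   nodes on levels 0, 1, 2, ...; the tip x is joined to all nodes of level n that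
   carry the prefix of length n of x.  Level n outnumbers all edges to lower
   levels, so two tips cannot be separated by fewer edges than level n has
   vertices if and only if they agree up to n.  Immersions do not decrease edge
   connectivity, so they act on the tips as nonexpanding injections X -> X.  A
   diagonalisation along a well-order of type continuum yields a dense X whose
   only such injection is the identity.

   Let G1 be the comb over X, and G2 a star with more leaves than anything in
   sight.  The graph P x, obtained from the comb by attaching the leaves of the
   star at the tip x, is an intertwine: in a graph H immersed in P x, the center
   of the star and the image of the tip x both land on the tip x, hence coincide,
   so H contains P x as well.  For the same reason P x is not immersed in P y if
   x <> y. *)

Set Implicit Arguments.
Unset Strict Implicit.
Unset Printing Implicit Defensive.

Local Open Scope classical_set_scope.

(** * A rigid set of binary sequences *)

Lemma wf_minimal (T : Type) (lt : T -> T -> Prop) (P : T -> Prop) :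
  well_founded lt -> (exists x, P x) ->
  exists2 x, P x & forall y, lt y x -> ~ P y.
Proof.
move=> wf [x0]; elim/(well_founded_ind wf): x0 => x IH Px.
have [[y ltyx Py]|nex] := pselect (exists2 y, lt y x & P y).
  exact: IH ltyx Py.
by exists x => // y ltyx Py; apply: nex; exists y.
Qed.

Lemma total_wf_order (T : eqType) : exists lt : T -> T -> Prop,
  well_founded lt /\ forall x y, x <> y -> lt x y \/ lt y x.
Proof.
have [R woR] := well_ordering_principle T.
exists (fun x y => ~~ R y x); split.
  move=> x; apply: contrapT => nAx.
  have /woR[z [[/asboolP nAz minz] _]] :
      nonempty [pred x | `[< ~ Acc (fun x y => ~~ R y x) x >]].
    by exists x; apply/asboolP.
  apply: nAz; constructor => y Rzy; apply: contrapT => nAy.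
  by case/negP: Rzy; apply: minz; apply/asboolP.
move=> x y neq_xy; apply: contrapT => /not_orP[/negP/negPn Ryx /negP/negPn Rxy].
(* Uniqueness of minima yields reflexivity on singletons and antisymmetry on pairs. *)
have lowP (P : pred T) x0 : P x0 -> exists z, [/\ P z, forall u, P u -> R z u
    & forall z', P z' -> (forall u, P u -> R z' u) -> z = z'].
  move=> Px0; have [|z [[Pz minz] uz]] := woR P; first by exists x0.
  by exists z; split=> // z' Pz' minz'; apply: uz; split.
have refl u : R u u.
  have [z [/eqP-> minz _]] := lowP (pred1 u) u (eqxx u).
  exact: minz u (eqxx u).
have [|z [_ _ uz]] := lowP (pred2 x y) x; first by rewrite /= eqxx.
apply: neq_xy; rewrite -(uz x) ?(uz y) //= ?eqxx ?orbT //.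
  by move=> w /orP[]/eqP->.
by move=> w /orP[]/eqP->.
Qed.

Definition functional (S T : Type) (D : S -> T -> Prop) : Prop :=
  forall s t t', D s t -> D s t' -> t = t'.

(* An order whose proper initial segments have smaller cardinality than the
   whole type, that is, do not map partially onto it. *)
Definition initial_order (T : Type) (lt : T -> T -> Prop) : Prop :=
  [/\ well_founded lt, forall x y, x <> y -> lt x y \/ lt y x
    & forall c (D : T -> T -> Prop), functional D ->
      exists r, forall h, lt h c -> ~ D h r].

(** Let [a] be the least point, if any, whose initial segment maps partially onto [T]. Choosing
    preimages embeds [T] by [g] into that segment; in the order pulled back along [g], a covering
    segment would contradict the minimality of [a]. *)
Lemma initial_order_exists (T : eqType) :
  exists lt : T -> T -> Prop, initial_order lt.
Proof.
have [lt [wf tot]] := total_wf_order T.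
pose covers a (D : T -> T -> Prop) :=
  functional D /\ forall r, exists h, lt h a /\ D h r.
have [/(wf_minimal wf)[a [D [funD /choice[g gP]]] mina]|ncov] :=
    pselect (exists a D, covers a D); last first.
  exists lt; split=> // c D funD; apply: contrapT => nr; apply: ncov.
  exists c, D; split=> // r; apply: contrapT => nh; apply: nr.
  by exists r => h lthc Dhr; apply: nh; exists h.
have injg r r' : g r = g r' -> r = r'.
  by move=> eqg; apply: funD (gP r).2 _; rewrite eqg; apply: (gP r').2.
exists (fun r r' => lt (g r) (g r')); split.
- exact: wf_inverse_image.
- by move=> x y neq; apply: tot => /injg.
- move=> c D' funD'; apply: contrapT => nr.
  apply: (mina (g c)); first exact: (gP c).1.
  exists (fun b r => exists2 h, g h = b & D' h r); split.
    by move=> b r r' [h <- Dr] [h' /injg-> Dr']; apply: funD' Dr Dr'.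
  move=> r; apply: contrapT => nh; apply: nr; exists r => h lth Dhr.
  by apply: nh; exists (g h); split=> //; exists h.
Qed.

Local Notation cantor := (nat -> bool).

(** König's argument: cut binary sequences into countably many columns, choose for each [j] a column
    that no value of [D j] below [c] has in place [j], and assemble these columns. *)
Lemma initial_order_countable (lt : cantor -> cantor -> Prop) (c : cantor)
    (D : nat -> cantor -> cantor -> Prop) :
  initial_order lt -> (forall j, functional (D j)) ->
  exists r, forall j h, lt h c -> ~ D j h r.
Proof.
move=> [_ _ small] funD.
pose col (r : cantor) (j : nat) : cantor := fun k => r (pickle (j, k)).
have /choice[q qP] j : exists q, forall h, lt h c ->
    ~ exists2 r, D j h r & q = col r j.
  apply: (small c (fun h q => exists2 r, D j h r & q = col r j)).
  by move=> h q q' [r Dr ->] [r' Dr' ->]; rewrite (funD _ _ _ _ Dr Dr').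
pose r : cantor := fun m =>
  if unpickle m : option (nat * nat) is Some jk then q jk.1 jk.2 else false.
exists r => j h lth Dr; apply: (qP j h lth); exists r => //.
by apply/funext => k; rewrite /col /r pickleK.
Qed.

(* Every map of the Cantor space whose [n]-th output bit depends only on the
   first [n.+1] input bits is [run c] for some [c]; the odd bits of [c] are
   unused, so that each such map has continuum many codes. *)
Definition run (c z : cantor) : cantor := fun n => c (pickle (mkseq z n.+1)).*2.

(** Transfinite recursion over codes, with [None] where no good point is left. The three
    inequalities keep the choices distinct and the images [run h w] out of the set of chosen
    points. *)
Lemma diagonal_choice (lt : cantor -> cantor -> Prop) : well_founded lt ->
  exists st : cantor -> option cantor,
    let good c z := run c z <> z /\ forall h w, lt h c -> st h = Some w ->
      [/\ z <> run h w, z <> w & run c z <> w] in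
    forall c, if st c is Some z then good c z else forall z, ~ good c z.
Proof.
move=> wf.
pose good c (prev : forall h, lt h c -> option cantor) z :=
  run c z <> z /\ forall h (lth : lt h c) w, prev h lth = Some w ->
    [/\ z <> run h w, z <> w & run c z <> w].
pose step c prev : option cantor :=
  if pselect (exists z, @good c prev z) is left ex then Some (projT1 (cid ex))
  else None.
exists (Fix wf _ step) => good' c; have -> : Fix wf _ step c =
    step c (fun h _ => Fix wf _ step h).
  apply: Fix_eq => x f g eqfg; congr step.
  by apply: functional_extensionality_dep => h; apply/funext => lth.
rewrite /step; case: pselect => [ex|nex].
  case: (cid ex) => z [neq zP] /=; split=> // h w lth; exact: zP.
by move=> z [neq zP]; apply: nex; exists z; split=> // h lth w; apply: zP.
Qed.

Lemma take_mkseq (T : Type) (f : nat -> T) m n : (m <= n)%N ->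
  take m (mkseq f n) = mkseq f m.
Proof. by move=> le_mn; rewrite -map_take take_iota (minn_idPl le_mn). Qed.

(** Bit [n] of [F x] can be read off the image of any point of [X] that shares the first [n.+1] bits
    of [x]. *)
Lemma nonexpanding_run (X : set cantor) (F : cantor -> cantor) :
  (forall x x' n, X x -> X x' -> mkseq x n = mkseq x' n ->
     mkseq (F x) n = mkseq (F x') n) ->
  exists c, forall x, X x -> run c x = F x.
Proof.
move=> nonexp.
pose P (u : seq bool) x := X x /\ mkseq x (size u) = u.
pose bit u := if pselect (exists x, P u x) is left ex
  then F (projT1 (cid ex)) (size u).-1 else false.
exists (fun k => if unpickle k./2 is Some u then bit u else false) => x Xx.
apply/funext => n; rewrite /run doubleK pickleK /bit.
case: pselect => [ex|[]]; last by exists x; split; rewrite // size_mkseq.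
case: (cid ex) => x' Px /=; rewrite size_map size_iota /=.
have [Xx' eqx] := Px; rewrite size_mkseq in eqx.
have := nonexp _ _ _ Xx' Xx eqx.
by move=> /(congr1 (nth false ^~ n)); rewrite !nth_mkseq.
Qed.

(* The codes of [flip s], which moves exactly the sequences starting with [s],
   produce continuum many points of the rigid set that start with [s]. *)
Definition flip (s : seq bool) (z : cantor) : cantor := fun n =>
  if (n == size s) && (mkseq z n == s) then ~~ z n else z n.

Lemma flip_codes (s : seq bool) : exists code : cantor -> cantor,
  injective code /\ forall r, run (code r) = flip s.
Proof.
pose bit u :=
  if (size u == (size s).+1) && (take (size s) u == s)
  then ~~ last false u else last false u.
exists (fun r k => if odd k then r k./2
                   else if unpickle k./2 is Some u then bit u else false).
split.
  move=> r r' eqr; apply/funext => k.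
  by have := congr1 (@^~ k.*2.+1) eqr; rewrite /= odd_double /= uphalf_double.
move=> r; apply/funext => z; apply/funext => n.
rewrite /run odd_double doubleK pickleK /bit size_mkseq eqSS /flip.
rewrite -nth_last size_mkseq nth_mkseq //=.
case: eqP => //= <-; congr (if _ == _ then _ else _).
exact: take_mkseq.
Qed.

Lemma rigid_set : exists X : set cantor,
  (forall s : seq bool, exists2 x, X x & mkseq x (size s) = s) /\
  forall F : cantor -> cantor,
    (forall x, X x -> X (F x)) ->
    (forall x x', X x -> X x' -> F x = F x' -> x = x') ->
    (forall x x' n, X x -> X x' -> mkseq x n = mkseq x' n ->
       mkseq (F x) n = mkseq (F x') n) ->
    forall x, X x -> F x = x.
Proof.
have [lt ord] := initial_order_exists cantor.
have [wf tot _] := ord; have [st /= stP] := diagonal_choice wf.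
(* [st c], if any, is a point of [X] whose image under [run c] is kept out of
   [X]; if there is none, then [run c] moves fewer than continuum many points
   of [X]. *)
pose X z := exists c, st c = Some z.
have goodP c z : st c = Some z -> run c z <> z /\ forall h w, lt h c ->
    st h = Some w -> [/\ z <> run h w, z <> w & run c z <> w].
  by move=> stc; have := stP c; rewrite stc.
(* One clause of [goodP] for each relative position of the stages [c] and [h]. *)
have avoid c h z w : st c = Some z -> st h = Some w -> z <> run h w.
  move=> stc sth eqz.
  have [eqch|/tot[ltch|lthc]] := pselect (c = h).
  - move: stc sth eqz; rewrite -eqch => stc; rewrite stc => -[<-].
    by apply/nesym; case: (goodP _ _ stc).
  - by have [_ /(_ _ _ ltch stc)[_ _]] := goodP _ _ sth; apply.
  - by have [_ /(_ _ _ lthc sth)[]] := goodP _ _ stc.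
have st_inj c h z : st c = Some z -> st h = Some z -> c = h.
  move=> stc sth; apply: contrapT => /tot[ltch|lthc].
    by have [_ /(_ _ _ ltch stc)[]] := goodP _ _ sth.
  by have [_ /(_ _ _ lthc sth)[]] := goodP _ _ stc.
(* The codes of [flip s] never fail, since earlier stages block fewer than continuum many points of
   the cylinder of [s]. As [flip s] moves only this cylinder, the chosen points lie in it. *)
have cyl (s : seq bool) : exists x : cantor -> cantor, exists code,
    [/\ injective x, injective code, forall r, st (code r) = Some (x r)
      & forall r, mkseq (x r) (size s) = s].
  have [code [code_inj codeE]] := flip_codes s.
  have /choice[x xP] r : exists x, st (code r) = Some x.
    have := stP (code r); case: (st _) => [x _|nogood]; first by exists x.
    exfalso.
    pose z (q : cantor) : cantor :=
      fun n => if (n < size s)%N then nth false s n else q (n - size s).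
    have zs q : mkseq (z q) (size s) = s.
      rewrite -[RHS](mkseq_nth false); apply/eq_in_map => n.
      by rewrite mem_iota /z => /= ->.
    have z_inj : injective z.
      move=> q q' eqz; apply/funext => n.
      have := congr1 (@^~ (size s + n)) eqz.
      by rewrite /z ltnNge leq_addr /= addKn.
    have flipzE q n : flip s (z q) n = (n == size s) (+) z q n.
      by rewrite /flip; case: eqP => //= ->; rewrite zs eqxx.
    have flipz_inj : injective (flip s \o z).
      move=> q q' /= eqz; apply: z_inj; apply/funext => n.
      by have := congr1 (@^~ n) eqz; rewrite !flipzE; apply: addbI.
    pose D j h q := exists2 w, st h = Some w &
      match j with 0 => z q = run h w | 1 => z q = w | _ => flip s (z q) = w end.
    have [|q qD] := initial_order_countable (code r) ord (D := D).
      move=> j h q q' [w sth wq] [w' ]; rewrite sth => -[<-].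
      move: wq; case: j => [|[|j]] <-; last by move/flipz_inj.
        by move/z_inj.
      by move/z_inj.
    apply: (nogood (z q)); rewrite codeE; split.
      move=> /(congr1 (@^~ (size s))); rewrite flipzE eqxx /=.
      by case: (z q _).
    move=> h w lth sth; split=> eqw.
    - by apply: (qD 0 h lth); exists w.
    - by apply: (qD 1 h lth); exists w.
    - by apply: (qD 2 h lth); exists w.
  exists x, code; split=> // [r r' eqx|r].
    by apply/code_inj/(st_inj _ _ (x r)); rewrite // eqx.
  have [neq _] := goodP _ _ (xP r); apply: contrapT => ns; apply: neq.
  rewrite codeE; apply/funext => n; rewrite /flip.
  by case: eqP => //= ->; case: eqP.
exists X; split=> [s|F FX F_inj F_nonexp x Xx].
  have [x [code [_ _ stx xs]]] := cyl s; exists (x point) => //.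
  by exists (code point).
have [c cF] := nonexpanding_run F_nonexp.
(* A point [w] chosen at stage [c] would lie in [X] together with [F w], against [avoid]. *)
have nogood z : ~ (run c z <> z /\ forall h w, lt h c -> st h = Some w ->
    [/\ z <> run h w, z <> w & run c z <> w]).
  have := stP c; case stc: (st c) => [w|]; last exact.
  have Xw : X w by exists c.
  have [h sth] := FX _ Xw.
  by case: (avoid _ _ _ _ sth stc); rewrite cF.
(* Fixed points of [F] arbitrarily close to [x] suffice, as [F] does not expand. *)
suff fixed n : exists2 w, X w & mkseq w n = mkseq x n /\ F w = w.
  apply/funext => n; have [w Xw [eqw Fw]] := fixed n.+1.
  have := F_nonexp _ _ _ Xw Xx eqw; rewrite Fw eqw.
  by move/(congr1 (nth false ^~ n)); rewrite !nth_mkseq.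
have [y [code [y_inj _ sty ys]]] := cyl (mkseq x n).
rewrite size_mkseq in ys.
have Xy r : X (y r) by exists (code r).
(* Some [y r] escapes all stages before [c]; if [F] moved it, it would be good for [c]. *)
pose D j h r := exists2 w, st h = Some w &
  match j with 0 => y r = w | _ => F (y r) = w end.
have [|r rD] := initial_order_countable c ord (D := D).
  move=> j h r r' [w sth wr] [w' ]; rewrite sth => -[<-].
  by move: wr; case: j => [|j] <-; [move/y_inj | move/(F_inj _ _ (Xy _) (Xy _))/y_inj].
exists (y r) => //; split=> //; apply: contrapT => neqF.
apply: (nogood (y r)); rewrite cF //; split=> // h w lth sth; split.
- exact: avoid (sty r) sth.
- by move=> eqw; apply: (rD 0 h lth); exists w.
- by move=> eqw; apply: (rD 1 h lth); exists w.
Qed.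

(** * Cardinality *)

Lemma cantor_injection (T : Type) (f : set T -> T) : ~ injective f.
Proof.
move=> f_inj; pose S := [set t | exists2 A, t = f A & ~ A t].
have [SfS|nSfS] := pselect (S (f S)); last by apply: (nSfS); exists S.
by have [A /f_inj <-] := SfS.
Qed.

(** Stage [n] has room for [T] copies of all levels below [n], where level [m] is the power set of
    stage [m]. *)
Fixpoint tower (T : Type) (n : nat) : Type :=
  if n is m.+1 then (tower T m + T * (tower T m -> Prop))%type else T.

(* Every level outnumbers the union of [T] copies of all lower levels; for
   [n = 0] this says that level [0] is inhabited. *)
Definition steep (T I : Type) (lv : I -> nat) : Prop :=
  forall n (g : I -> T * I), (forall i, lv i = n -> (lv (g i).2 < n)%N) ->
  ~ (forall i j, lv i = n -> lv j = n -> g i = g j -> i = j).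

(** An injection of level [n] into [T] copies of the lower levels would embed the power set of
    [tower T n] in [tower T n], against Cantor. *)
Lemma steep_exists (T : Type) : exists (I : Type) (lv : I -> nat), steep T lv.
Proof.
pose I := {n & tower T n -> Prop}; pose lv (i : I) := projT1 i.
have cd n : exists cd : T * I -> tower T n, forall p q,
    (lv p.2 < n)%N -> (lv q.2 < n)%N -> cd p = cd q -> p = q.
  elim: n => [|n [cd cd_inj]]; first by exists fst.
  exists (fun p => if pselect (exists A, p.2 = existT _ n A) is left ex
                   then inr (p.1, projT1 (cid ex)) else inl (cd p)).
  have lvlt i : (lv i < n.+1)%N -> ~ (exists A, i = existT _ n A) -> (lv i < n)%N.
    rewrite ltnS leq_eqVlt => /orP[/eqP|//].
    by case: i => m A /= eqmn []; rewrite -eqmn; exists A.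
  move=> p q ltp ltq; case: pselect => [exp|nexp]; case: pselect => [exq|nexq] //.
    case: (cid exp) (cid exq) => A eA [B eB] /= [eqt eqAB].
    by apply: injective_projections; rewrite // eA eB eqAB.
  by case=> /cd_inj; apply; apply: lvlt.
exists I, lv => n g glt g_inj; have [c c_inj] := cd n.
apply: (@cantor_injection _ (fun A => c (g (existT _ n A)))) => A B eqc.
apply: (inj_pair2_eq_dec nat Nat.eq_dec (fun m => tower T m -> Prop) n).
by apply: g_inj => //; apply: c_inj eqc; apply: glt.
Qed.

(* [nat * B] absorbs a duplication, so [set (nat * B)] contains the square of
   itself; a set too small to meet every row of the square misses a whole row. *)
Lemma avoid_small (B : Type) (D : nat * B -> set (nat * B) -> Prop) :
  (forall u A A', D u A -> D u A' -> A = A') ->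
  exists h : set (nat * B) -> set (nat * B),
    injective h /\ forall A u, ~ D u (h A).
Proof.
move=> funD.
pose pair (P Q : set (nat * B)) : set (nat * B) :=
  [set u | if odd u.1 then P (u.1./2, u.2) else Q (u.1./2, u.2)].
have pair_injl P Q P' Q' : pair P Q = pair P' Q' -> P = P'.
  move=> eqp; apply/funext => -[n b].
  have := congr1 (@^~ (n.*2.+1, b)) eqp.
  by rewrite /pair /= odd_double /= uphalf_double.
have pair_injr P Q P' Q' : pair P Q = pair P' Q' -> Q = Q'.
  move=> eqp; apply/funext => -[n b].
  have := congr1 (@^~ (n.*2, b)) eqp.
  by rewrite /pair /= odd_double /= doubleK.
suff [P Pok] : exists P, forall Q u, ~ D u (pair P Q).
  by exists (pair P); split=> // Q Q' /pair_injr.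
apply: contrapT => /forallNP bad.
(* Diagonal set: if [D] met every row, it would meet that of [S] at some [u], and [S u] would hold
   exactly if it fails. *)
pose S : set (nat * B) := [set u | exists P Q, D u (pair P Q) /\ ~ P u].
have /existsNP[Q /existsNP[u /contrapT Du]] := bad S.
have [Su|nSu] := pselect (S u); last first.
  by apply: (nSu); exists S, Q; split; [exact: Du | exact: nSu].
have [P [Q' [Du' nPu]]] := Su.
by apply: nPu; rewrite (pair_injl _ _ _ _ (funD _ _ _ Du' Du)).
Qed.

(** * Immersions and edge cuts *)

Definition boundary (G : graph) (K : set (vertex G)) : set (set (vertex G)) :=
  [set e | edges G e /\ exists x y, [/\ e = [set x; y], K x & ~ K y]].

(* The part of an immersion that survives composition without concatenating
   paths. *)
Definition cut_embedding (H G : graph) (f : vertex H -> vertex G) : Prop :=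
  injective f /\ forall K, exists g : set (vertex H) -> set (vertex G),
    (forall e, boundary (f @^-1` K) e -> boundary K (g e)) /\
    forall e e', boundary (f @^-1` K) e -> boundary (f @^-1` K) e' ->
      g e = g e' -> e = e'.

Lemma cut_embedding_comp (H G F : graph) (f : vertex H -> vertex G)
    (g : vertex G -> vertex F) :
  cut_embedding f -> cut_embedding g -> cut_embedding (g \o f).
Proof.
move=> [f_inj fP] [g_inj gP]; split; first exact: inj_comp.
move=> K; have [a [aK a_inj]] := gP K; have [b [bK b_inj]] := fP (g @^-1` K).
exists (a \o b); split=> [e eK|e e' eK eK' /= eqab]; first exact/aK/bK.
by apply: b_inj => //; apply: a_inj => //; apply: bK.
Qed.

Lemma path_edges_crossing (V : Type) (K : set V) (x y : V) (s : seq V) :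
  K x -> ~ K y -> exists a b,
    [/\ path_edges (x :: rcons s y) [set a; b], K a & ~ K b].
Proof.
elim: s x => [|z s IH] x Kx Ky /=; first by exists x, y; split=> //; left.
have [Kz|Kz] := pselect (K z); last by exists x, z; split=> //; left.
by have [a [b [pab Ka Kb]]] := IH z Kz Ky; exists a, b; split=> //; right.
Qed.

Lemma connects_crossing (V : Type) (K : set V) (x y : V) (p : seq V) :
  connects p x y -> K x -> ~ K y -> exists a b,
    [/\ path_edges p [set a; b], K a & ~ K b].
Proof.
move=> [s [->|->]] Kx Ky; first exact: path_edges_crossing.
have [|a [b [pab Ka Kb]]] := @path_edges_crossing _ (~` K) y x s Ky; first by [].
by exists b, a; rewrite setUC; split=> //; apply: contrapT.
Qed.

Definition immersion (H G : graph) (f : vertex H -> vertex G)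
    (p : set (vertex H) -> seq (vertex G)) : Prop :=
  [/\ forall v v', v <> v' -> f v <> f v',
      forall e, edges H e -> paths G (p e),
      forall v v', edges H [set v; v'] -> connects (p [set v; v']) (f v) (f v'),
      forall e e', edges H e -> edges H e' -> e <> e' ->
        path_edges (p e) `&` path_edges (p e') = set0
    & forall e v, edges H e -> ~ e v -> ~ path_vertices (p e) (f v)].

(** The path of an edge in the boundary of the preimage of [K] must cross the boundary of [K];
    edge-disjointness makes the crossings chosen on different paths distinct. *)
Lemma immersion_cut_embedding (H G : graph) (f : vertex H -> vertex G) p :
  immersion f p -> cut_embedding f.
Proof.
move=> [f_inj p_path p_ends p_disj _]; split.
  by move=> v v' eqf; apply: contrapT => /f_inj.
move=> K.
have /choice[g gP] e : exists e', boundary (f @^-1` K) e ->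
    path_edges (p e) e' /\ boundary K e'.
  have [[He [x [y [ee Kx Ky]]]]|nK] := pselect (boundary (f @^-1` K) e); last first.
    by exists set0.
  have : edges H [set x; y] by rewrite -ee.
  move=> /p_ends; rewrite -ee => conn.
  have [a [b [pab Ka Kb]]] := connects_crossing conn (K := K) Kx Ky.
  exists [set a; b] => _; split=> //; split; last by exists a, b.
  by have [_ _] := p_path _ He; apply.
exists g; split=> [e /gP[]//|e e' eK eK' eqg]; apply: contrapT => neq.
have [pe _] := gP _ eK; have [pe' _] := gP _ eK'.
suff : (path_edges (p e) `&` path_edges (p e')) (g e).
  by rewrite (p_disj _ _ eK.1 eK'.1 neq).
by split; rewrite // eqg.
Qed.

Lemma set2_eq (T : Type) (a b c d : T) : [set a; b] = [set c; d] ->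
  (a = c /\ b = d) \/ (a = d /\ b = c).
Proof.
move=> eqs.
have mem u : (u = a \/ u = b) <-> (u = c \/ u = d).
  by change ([set a; b] u <-> [set c; d] u); rewrite eqs.
have [+ _] := mem a; have [+ _] := mem b; have [_ +] := mem c.
have [_ +] := mem d; intuition congruence.
Qed.

Lemma image_set2 (S T : Type) (f : S -> T) x y :
  f @` [set x; y] = [set f x; f y].
Proof. by rewrite image_setU !image_set1. Qed.

Lemma image_injective (S T : Type) (f : S -> T) :
  injective f -> injective (fun A : set S => f @` A).
Proof.
move=> f_inj A B eqAB; apply/seteqP; split=> x Ax.
  have : (f @` B) (f x) by rewrite -eqAB; exists x.
  by case=> y By /f_inj <-.
have : (f @` A) (f x) by rewrite eqAB; exists x.
by case=> y Ay /f_inj <-.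
Qed.

Lemma subgraph_immersion (H G : graph) (f : vertex H -> vertex G) :
  injective f -> (forall e, edges H e -> edges G (f @` e)) ->
  exists p, immersion f p.
Proof.
move=> f_inj fE.
have /choice[p pP] e : exists p, edges H e ->
    exists x y, [/\ x <> y, e = [set x; y] & p = [:: f x; f y]].
  have [He|nHe] := pselect (edges H e); last by exists nil.
  have [x [y [neq ->]]] := edges_two_elements He.
  by exists [:: f x; f y] => _; exists x, y.
have pE e : edges H e -> path_edges (p e) = [set f @` e].
  by move=> /pP[x [y [_ -> ->]]] /=; rewrite image_set2 setU0.
exists p; split.
- by move=> v v' neq /f_inj.
- move=> e He; split; last by rewrite pE // => _ ->; exact: fE.
    by have [x [y [_ _ ->]]] := pP e He.
  have [x [y [neq _ ->]]] := pP e He.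
  apply: List.NoDup_cons; last by apply: List.NoDup_cons => //; apply: List.NoDup_nil.
  by case=> // /f_inj /esym.
- move=> v v' Hv; have [x [y [neq eqs ->]]] := pP _ Hv; exists nil.
  by have [[-> ->]|[-> ->]] := set2_eq eqs; [left|right].
- move=> e e' He He' neq; rewrite !pE //; apply/seteqP; split=> // d [-> eqd].
  by apply: neq; apply: image_injective eqd.
- move=> e v He; have [x [y [neq -> ->]]] := pP e He => nv [|[|//]] /f_inj eqv.
    by apply: nv; left.
  by apply: nv; right.
Qed.

(** * Graphs with pendant leaves *)

Definition pendant_edges (G : graph) (v : vertex G) (L : Type) :
    set (set (vertex G + L)) :=
  [set e | (exists2 d, edges G d & e = inl @` d) \/
           exists l, e = [set inl v; inr l]].

Arguments pendant_edges {G} v L.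

Lemma pendant_edges_two_elements (G : graph) (v : vertex G) (L : Type) e :
  pendant_edges v L e -> exists x y, x <> y /\ e = [set x; y].
Proof.
move=> [[d /edges_two_elements[x [y [neq ->]]] ->]|[l ->]].
  by exists (inl x), (inl y); split; [case|rewrite image_set2].
by exists (inl v), (inr l).
Qed.

Definition pendant (G : graph) (v : vertex G) (L : Type) : graph :=
  Graph (@pendant_edges_two_elements G v L).

Definition point_graph : graph :=
  @Graph unit set0 (fun e (e0 : set0 e) => match e0 with end).

Definition star (L : Type) : graph := pendant (G := point_graph) tt L.

Lemma inl_injective (S T : Type) : injective (@inl S T).
Proof. by move=> x y []. Qed.

(* Too many leaves for the images of the vertices of [G] and of the paths
   representing its edges to meet them all.  The universe of [set _] lies above
   the vertex types of graphs, hence the arrows into [Prop]. *)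
Definition leaves (G : graph) : Type :=
  nat * (vertex G + (vertex G -> Prop)) -> Prop.

Lemma star_edge (L : Type) (l : L) : edges (star L) [set inl tt; inr l].
Proof. by right; exists l. Qed.

Lemma star_boundary (L : Type) (G : graph) (f : vertex (star L) -> vertex G) l :
  injective f ->
  boundary (G := star L) (f @^-1` [set f (inl tt)]) [set inl tt; inr l].
Proof.
move=> f_inj; split; first exact: star_edge.
by exists (inl tt), (inr l); split=> // /f_inj.
Qed.

(** Take for [K] the image of the centre alone: distinct edges at one vertex have distinct other
    ends. *)
Lemma star_neighbours (L : Type) (G : graph) (f : vertex (star L) -> vertex G) :
  cut_embedding f -> exists w : L -> vertex G, injective w /\
    forall l, edges G [set f (inl tt); w l].
Proof.
move=> [f_inj /(_ [set f (inl tt)])[g [gK g_inj]]].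
have /choice[w wP] l : exists w,
    g [set inl tt; inr l] = [set f (inl tt); w] /\ edges G [set f (inl tt); w].
  have [Ge [x [y [eqe Kx _]]]] := gK _ (star_boundary l f_inj).
  by exists y; rewrite -(Kx : x = _) -eqe.
exists w; split=> [l l' eqw|l]; last by have [] := wP l.
have : g [set inl tt; inr l] = g [set inl tt; inr l'].
  by rewrite (wP l).1 (wP l').1 eqw.
move=> /(g_inj _ _ (star_boundary l f_inj) (star_boundary l' f_inj)) eqs.
by case: (set2_eq eqs) => [[_ []]|[]].
Qed.

(** Any vertex other than [inl v] has all its neighbours in [G], and the leaves do not inject into
    the vertices of [G]. *)
Lemma star_center (G : graph) (v : vertex G)
    (f : vertex (star (leaves G)) -> vertex (pendant v (leaves G))) :
  cut_embedding f -> f (inl tt) = inl v.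
Proof.
move=> /star_neighbours[w [w_inj wE]]; apply: contrapT => neqv.
have /choice[u uw] l : exists u, w l = inl u.
  have [[d /edges_two_elements[x [y [_ ->]]]]|[l']] := wE l.
    rewrite image_set2 => eqs; have [[_ ->]|[_ ->]] := set2_eq eqs.
      by exists y.
    by exists x.
  by move=> eqs; have [[]|[_ ->]] := set2_eq eqs; last by exists v.
pose c A : nat * (vertex G + (vertex G -> Prop)) := (0, inl (u A)).
apply: (@cantor_injection _ c) => A B [eqc].
by apply: w_inj; rewrite !uw eqc.
Qed.

(** The index [(n, inl v)] stands for the obstacle [f v], and [(n, inr e)] for vertex [n] of the
    path [p e]. Each hits at most one leaf, so [avoid_small] re-indexes the leaves past all
    obstacles. *)
Lemma leaf_neighbours_avoid (G H : graph) (f : vertex G -> vertex H)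
    (p : set (vertex G) -> seq (vertex H)) (w : leaves G -> vertex H) :
  injective w -> exists w' : leaves G -> vertex H,
    [/\ injective w', forall l, exists l', w' l = w l',
        forall l u, w' l <> f u & forall l e, ~ path_vertices (p e) (w' l)].
Proof.
move=> w_inj.
pose hit (u : nat * (vertex G + (vertex G -> Prop))) (l : leaves G) :=
  match u.2 with inl v => w l = f v
  | inr e => List.nth_error (p e) u.1 = Some (w l) end.
have [u l l'|h [h_inj hP]] := avoid_small (D := hit).
  case: u => n [v|e]; rewrite /hit /=; first by move=> <- /w_inj.
  by move=> -> [/w_inj].
exists (w \o h); split=> [|l|l u eqw|l e /(@List.In_nth_error _ _ _)[n wn]].
- exact: inj_comp.
- by exists (h l).
- exact: (hP l (0, inl u)).
- exact: (hP l (n, inr e)).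
Qed.

Lemma path_edges_vertices (V : Type) (p : seq V) e x :
  path_edges p e -> e x -> path_vertices p x.
Proof.
elim: p => [//|a [//|b p] IH] [->|pe] ex; last by right; apply: IH.
by case: ex => ->; [left|right; left].
Qed.

Lemma pendant_immersed (G H : graph) (v : vertex G) (L : Type)
    (f : vertex G -> vertex H) p (w : L -> vertex H) :
  immersion f p -> injective w -> (forall l, edges H [set f v; w l]) ->
  (forall l u, w l <> f u) -> (forall l e, ~ path_vertices (p e) (w l)) ->
  immersed (pendant v L) H.
Proof.
move=> [f_inj p_path p_ends p_disj p_avoid] w_inj wE wf wp.
pose f' (x : vertex (pendant v L)) := match x with inl u => f u | inr l => w l end.
pose leaf e := exists l : L, e = [set inl v; inr l].
pose p' (e : set (vertex (pendant v L))) := if pselect (leaf e) is left ex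
  then [:: f v; w (projT1 (cid ex))] else p (inl @^-1` e).
have p'_leaf l : p' [set inl v; inr l] = [:: f v; w l].
  rewrite /p'; case: pselect => [ex|[]]; last by exists l.
  by case: (cid ex) => l' /= eqs; have [[_ [->]]|[]] := set2_eq eqs.
have inl_preimage (d : set (vertex G)) : inl @^-1` (@inl _ L @` d) = d.
  by apply/seteqP; split=> x; [case=> y dy [<-] | exists x].
have p'_inl d : p' (inl @` d) = p d.
  rewrite /p' inl_preimage; case: pselect => // -[l eqs].
  have : (inl @` d) (inr l : vertex G + L) by rewrite eqs; right.
  by case.
exists f', p'; split.
- move=> [u|l] [u'|l'] neq /=.
  + by apply: f_inj => equ; apply: neq; rewrite equ.
  + exact/nesym/wf.
  + exact: wf.
  + by move/w_inj => eql; apply: neq; rewrite eql.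
- move=> e [[d Gd ->]|[l ->]]; first by rewrite p'_inl; apply: p_path.
  rewrite p'_leaf; split=> //; last by rewrite /= setU0 => _ ->.
  apply: List.NoDup_cons; last by apply: List.NoDup_cons => //; apply: List.NoDup_nil.
  by case=> //; apply: wf.
- move=> x y [[d Gd eqs]|[l eqs]]; rewrite eqs.
    have [a [b [_ eqd]]] := edges_two_elements Gd.
    have dE : edges G [set a; b] by rewrite -eqd.
    rewrite p'_inl eqd; rewrite eqd image_set2 in eqs.
    have [[-> ->]|[-> ->]] := set2_eq eqs; first exact: p_ends.
    by rewrite setUC; apply: p_ends; rewrite setUC.
  by rewrite p'_leaf; exists nil; have [[-> ->]|[-> ->]] := set2_eq eqs; [left|right].
- have cross d l : path_edges (p d) `&` path_edges [:: f v; w l] = set0.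
    apply/seteqP; split=> // e [pe []// eqe]; apply: (wp l d).
    by apply: path_edges_vertices pe _; rewrite eqe; right.
  move=> e e' [[d Gd ->]|[l ->]] [[d' Gd' ->]|[l' ->]] neq;
    rewrite ?p'_inl ?p'_leaf //.
  + by apply: p_disj => // eqd; apply: neq; rewrite eqd.
  + by rewrite setIC.
  + rewrite /= !setU0; apply/seteqP; split=> // _ [-> eqs].
    have [[_ /w_inj eql]|[/esym/wf//]] := set2_eq eqs.
    by apply: neq; rewrite eql.
- move=> e x [[d Gd ->]|[l ->]] nx.
    rewrite p'_inl; case: x nx => [u|l] nx; last exact: wp.
    by apply: p_avoid => // du; apply: nx; exists u.
  rewrite p'_leaf; case: x nx => [u|l'] nx /= [|[|//]].
  + by apply: f_inj => equ; apply: nx; left; rewrite equ.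
  + exact: wf.
  + by move/nesym; case; apply: wf.
  + by move/w_inj => eql; apply: nx; right; rewrite eql.
Qed.

Lemma pendant_immersion (G : graph) (v : vertex G) (L : Type) :
  exists p, immersion (G := pendant v L) inl p.
Proof.
apply: subgraph_immersion; first exact: inl_injective.
by move=> e Ge; left; exists e.
Qed.

Definition pendant_star (G : graph) (v : vertex G) (L : Type)
    (x : vertex (star L)) : vertex (pendant v L) :=
  match x with inl _ => inl v | inr l => inr l end.

Lemma star_pendant_immersion (G : graph) (v : vertex G) (L : Type) :
  exists p, immersion (@pendant_star G v L) p.
Proof.
apply: subgraph_immersion; first by move=> [[]|l] [[]|l'] // [->].
by move=> e [[d []]|[l ->]]; right; exists l; rewrite image_set2.
Qed.

Lemma infinite_injection (S T : Type) (f : S -> T) (A : set S) (B : set T) :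
  (forall x y, A x -> A y -> f x = f y -> x = y) ->
  (forall x, A x -> B (f x)) -> infinite_set A -> infinite_set B.
Proof.
move=> f_inj AB infA finB; apply: infA.
have f_injA : {in A &, injective f}.
  by move=> x y /set_mem Ax /set_mem Ay; apply: f_inj.
rewrite -(eq_finite_set (inj_card_eq f_injA)).
by apply: sub_finite_set finB => _ [x Ax <-]; apply: AB.
Qed.

Lemma pendant_intertwine (G : graph) (v : vertex G) :
  infinite_graphs G ->
  (forall f : vertex G -> vertex (pendant v (leaves G)),
     cut_embedding f -> f v = inl v) ->
  intertwines infinite_graphs immersed G (star (leaves G)) (pendant v (leaves G)).
Proof.
move=> infG fix_v; split.
- by apply: (infinite_injection (f := inl)) infG => // x y _ _ [].
- by exists inl; apply: pendant_immersion.
- by exists (@pendant_star G v (leaves G)); apply: star_pendant_immersion.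
- move=> H _ [th [q thq]] notle; apply: contrapT => /not_orP.
  move=> [/contrapT[f [p fp]] /contrapT[s [r sr]]]; apply: notle.
  have th_cut := immersion_cut_embedding thq.
  have f_cut := immersion_cut_embedding fp.
  have s_cut := immersion_cut_embedding sr.
  have fsv : s (inl tt) = f v.
    apply: th_cut.1; have := star_center (cut_embedding_comp s_cut th_cut) => /= ->.
    by have := fix_v _ (cut_embedding_comp f_cut th_cut) => /= ->.
  have [w [w_inj wE]] := star_neighbours s_cut.
  have [w' [w'_inj w'E w'f w'p]] := leaf_neighbours_avoid f p w_inj.
  apply: pendant_immersed fp w'_inj _ w'f w'p => l.
  by have [l' ->] := w'E l; rewrite -fsv.
Qed.

(** * Combs *)

(** Tips outside [X], and nodes whose word does not have the length of their level, will be isolated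
    vertices of the comb. *)
Inductive comb_vertex (I : Type) : Type :=
  Tip of cantor | Node of seq bool & I.

Arguments Tip {I}.

Definition comb_edges (I : Type) (lv : I -> nat) (X : set cantor) :
    set (set (comb_vertex I)) :=
  [set e | exists x i, X x /\ e = [set Tip x; Node (mkseq x (lv i)) i]].

Lemma comb_edges_two_elements (I : Type) (lv : I -> nat) X e :
  comb_edges lv X e -> exists x y, x <> y /\ e = [set x; y].
Proof. by move=> [x [i [_ ->]]]; exists (Tip x), (Node (mkseq x (lv i)) i). Qed.

Definition comb (I : Type) (lv : I -> nat) (X : set cantor) : graph :=
  Graph (@comb_edges_two_elements I lv X).

Lemma steep_level0 (I : Type) (lv : I -> nat) : steep cantor lv -> exists i, lv i = 0.
Proof.
move=> lv_steep; apply: contrapT => no0.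
apply: (lv_steep 0 (fun i => (fun=> true, i))) => [i i0|i j i0];
  by case: no0; exists i.
Qed.

Section CombRigidity.
Variables (I : Type) (lv : I -> nat) (X : set cantor).
Variables (L : Type) (a : cantor).
Hypotheses (lv_steep : steep cantor lv) (Xa : X a).

Let R := comb lv X.
Let P := pendant (G := R) (Tip a) L.

Variable f : vertex R -> vertex P.
Hypothesis f_cut : cut_embedding f.

Lemma pendant_comb_edge e : edges P e ->
  (exists y i, X y /\ e = [set inl (Tip y); inl (Node (mkseq y (lv i)) i)]) \/
  (exists l, e = [set inl (Tip a); inr l]).
Proof.
move=> [[d [y [i [Xy ->]]] ->]|]; last by right.
by left; exists y, i; rewrite image_set2.
Qed.

Lemma comb_edge x i : X x -> edges R [set Tip x; Node (mkseq x (lv i)) i].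
Proof. by exists x, i. Qed.

(* Vertices other than tips have at most continuum degree. *)
Lemma tip_to_tip x : X x -> exists2 y, X y & f (Tip x) = inl (Tip y).
Proof.
move=> Xx; apply: contrapT => ntip.
have [f_inj /(_ [set f (Tip x)])[g [gK g_inj]]] := f_cut.
pose e i : set (vertex R) := [set Tip x; Node (mkseq x (lv i)) i].
have eK i : boundary (f @^-1` [set f (Tip x)]) (e i).
  split; first exact: comb_edge.
  by exists (Tip x), (Node (mkseq x (lv i)) i); split=> // /f_inj.
have /choice[y yP] i : exists y, g (e i) = [set f (Tip x); inl (Tip y)].
  have [/pendant_comb_edge Pe [u [v [eqe Ku _]]]] := gK _ (eK i).
  rewrite eqe (Ku : u = _) in Pe *.
  case: Pe => [[y [j [Xy eqs]]]|[l eqs]].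
    have [[eqf _]|[-> ->]] := set2_eq eqs; last by exists y.
    by case: ntip; exists y.
  have [[eqf _]|[-> ->]] := set2_eq eqs; last by exists a.
  by case: ntip; exists a.
have [i0 i00] := steep_level0 lv_steep.
(* Level 1 does not embed in the copies of a single point of level 0 indexed by [cantor]. *)
apply: (@lv_steep 1 (fun i => (y i, i0))) => [i _|i j _ _ [eqy]] /=.
  by rewrite i00.
have /(g_inj _ _ (eK i) (eK j)) eqs : g (e i) = g (e j) by rewrite !yP eqy.
by have [[_ []]|[]] := set2_eq eqs.
Qed.

(* Two tips that agree up to [n] have level [n] many common neighbours, while
   the cone of the sequences that extend a given one of length [n] is left only
   by edges to lower levels. *)
Lemma tip_nonexpanding x x' y y' n : X x -> X x' ->
  f (Tip x) = inl (Tip y) -> f (Tip x') = inl (Tip y') ->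
  mkseq x n = mkseq x' n -> mkseq y n = mkseq y' n.
Proof.
move=> Xx Xx' fx fx' eqx; apply: contrapT => neqy.
(* The leaves are put on the side of their tip [a], so that no leaf edge crosses. *)
pose K : set (vertex P) := fun v => match v with
  | inl (Tip z) => mkseq z n = mkseq y n
  | inl (Node s i) => take n s = mkseq y n /\ (n <= lv i)%N
  | inr _ => mkseq a n = mkseq y n end.
have [_ /(_ K)[g [gK g_inj]]] := f_cut.
pose b i : vertex R := Node (mkseq x n) i.
(* The edge joins [b i] to the tip mapped to the other side of [K]: [x] goes inside, [x']
   outside. *)
pose e i : set (vertex R) := [set if pselect (K (f (b i))) then Tip x' else Tip x; b i].
have eK i : lv i = n -> boundary (f @^-1` K) (e i).
  move=> lvi; rewrite /e; case: pselect => Kb /=.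
    split; first by rewrite /b eqx -lvi; apply: comb_edge.
    exists (b i), (Tip x'); rewrite setUC; split=> //.
    by rewrite /= fx' => /esym.
  split; first by rewrite /b -lvi; apply: comb_edge.
  by exists (Tip x), (b i); split; rewrite //= fx.
have /choice[z zP] i : exists z, lv i = n ->
    g (e i) = [set inl (Tip z.1); inl (Node (mkseq z.1 (lv z.2)) z.2)] /\
    (lv z.2 < n)%N.
  have [lvi|nlvi] := pselect (lv i = n); last by exists (a, i).
  have [/pendant_comb_edge Pe [u [v [eqe Ku Kv]]]] := gK _ (eK i lvi).
  case: Pe => [[t [j [Xt eqt]]]|[l eql]].
    exists (t, j) => _; split=> //=; rewrite ltnNge; apply/negP => le_nj.
    (* A tip and its neighbour on a level at least [n] lie on the same side, so crossing edges end
       below level [n]. *)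
    have Kt : K (inl (Tip t)) <-> K (inl (Node (mkseq t (lv j)) j)).
      by rewrite /= take_mkseq //; split=> [|[]].
    rewrite eqe in eqt; have [[eu ev]|[eu ev]] := set2_eq eqt.
      by apply: Kv; rewrite ev; apply/Kt; rewrite -eu.
    by apply: Kv; rewrite ev; apply/Kt; rewrite -eu.
  rewrite eqe in eql; have [[eu ev]|[eu ev]] := set2_eq eql;
    by case: Kv; rewrite ev; rewrite eu in Ku.
apply: (@lv_steep n z) => [i /zP[]//|i j lvi lvj eqz].
have /(g_inj _ _ (eK i lvi) (eK j lvj)) : g (e i) = g (e j).
  by rewrite (zP i lvi).1 (zP j lvj).1 eqz.
move=> /(congr1 (@^~ (b i))) /= eqs.
have : e j (b i) by rewrite /= -eqs; right.
by case; [case: pselect|case].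
Qed.

End CombRigidity.

Lemma comb_rigid (I : Type) (lv : I -> nat) : steep cantor lv ->
  exists X : set cantor, infinite_set X /\
    forall a (L : Type)
        (f : vertex (comb lv X) -> vertex (pendant (G := comb lv X) (Tip a) L)),
      X a -> cut_embedding f -> forall x, X x -> f (Tip x) = inl (Tip x).
Proof.
move=> lv_steep; have [X [X_dense X_rigid]] := rigid_set; exists X; split.
  (* By density, [X] has points that start with exactly [n] ones, for every [n]. *)
  have /choice[x xP] (n : nat) : exists x, X x /\
      mkseq x n.+1 = rcons (nseq n true) false.
    have [x Xx eqx] := X_dense (rcons (nseq n true) false).
    by exists x; rewrite size_rcons size_nseq in eqx.
  apply: (infinite_injection (f := x)) infinite_nat => [m n _ _ eqx|n _]; last first.
    by have [] := xP n.
  have bit k i : x k i = nth true (rcons (nseq k true) false) i \/ (k < i)%N.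
    have [le_ik|] := leqP i k; last by right.
    by left; rewrite -(xP k).2 nth_mkseq.
  suff lt k l : (k < l)%N -> x k <> x l.
    by have [/lt|/lt/(_ (esym eqx))|//] := ltngtP m n.
  move=> lt_kl eqkl; have := bit k k; rewrite eqkl ltnn => -[|//].
  rewrite nth_rcons size_nseq ltnn eqxx.
  have := bit l k; rewrite ltnNge (ltnW lt_kl) => -[->|//].
  by rewrite nth_rcons size_nseq lt_kl nth_nseq lt_kl.
move=> a L f Xa f_cut.
have /choice[F FP] x : exists y, X x -> X y /\ f (Tip x) = inl (Tip y).
  have [Xx|nXx] := pselect (X x); last by exists x.
  by have [y Xy fx] := tip_to_tip lv_steep Xa f_cut Xx; exists y.
suff F_id x : X x -> F x = x by move=> x Xx; rewrite (FP x Xx).2 F_id.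
apply: (X_rigid F) => [{}x /FP[]//|{}x x' Xx Xx' eqF|{}x x' n Xx Xx' eqx].
  have : f (Tip x) = f (Tip x') by rewrite (FP x Xx).2 (FP x' Xx').2 eqF.
  by move=> /f_cut.1[].
exact: (tip_nonexpanding lv_steep f_cut Xx Xx' (FP x Xx).2 (FP x' Xx').2 eqx).
Qed.

(** * An infinite antichain of intertwines *)

Theorem theorem2 :
  ~ finite_intertwine_property infinite_graphs immersed /\
  exists G1 G2 : graph,
    [/\ infinite_graphs G1, infinite_graphs G2
      & exists S : set graph,
          [/\ S `<=` intertwines infinite_graphs immersed G1 G2,
              antichain immersed S & infinite_set S]].
Proof.
suff ex : exists G1 G2 : graph,
    [/\ infinite_graphs G1, infinite_graphs G2
      & exists S : set graph,
          [/\ S `<=` intertwines infinite_graphs immersed G1 G2,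
              antichain immersed S & infinite_set S]].
  by split=> // fip; have [G1 [G2 [infG1 infG2]]] := ex; apply: fip.
have [I [lv lv_steep]] := steep_exists cantor.
have [X [X_inf X_rigid]] := comb_rigid lv_steep.
pose R := comb lv X; pose P x := pendant (G := R) (Tip x) (leaves R).
have R_inf : infinite_graphs R.
  by apply: (infinite_injection (f := Tip)) X_inf => // x y _ _ [].
(* Restricted to the comb, [f] fixes the tip [x]; restricted to the star, it sends the centre, which
   is the same vertex, to the tip [y]. *)
have P_tip x y (f : vertex (P x) -> vertex (P y)) : X x -> X y ->
    cut_embedding f -> x = y.
  move=> Xx Xy f_cut.
  have [p /immersion_cut_embedding R_cut] := pendant_immersion (G := R) (Tip x) (leaves R).
  have := X_rigid y _ _ Xy (cut_embedding_comp R_cut f_cut) x Xx.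
  move=> /= fx.
  have [q /immersion_cut_embedding g_cut] :=
    star_pendant_immersion (G := R) (Tip x) (leaves R).
  have := star_center (cut_embedding_comp g_cut f_cut).
  by rewrite /= fx => -[].
exists R, (star (leaves R)); split=> //.
  pose l n : leaves R := [set (n, inr (fun=> True))].
  apply: (infinite_injection (f := inr \o l)) infinite_nat => // m n _ _ [eql].
  have : l n (m, inr (fun=> True)) by rewrite -eql.
  by case.
exists (P @` X); split.
- move=> _ [x Xx <-]; apply: pendant_intertwine => // f f_cut.
  exact: (X_rigid x _ f Xx f_cut x Xx).
- move=> _ _ [x Xx <-] [y Xy <-] neq [f [p fp]]; apply: neq.
  by rewrite (P_tip x y f) //; apply: immersion_cut_embedding fp.
- apply: (infinite_injection (f := P)) X_inf => [x y Xx Xy eqP|x Xx]; last by exists x.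
  (* Equal graphs have the identity as a cut embedding, so [P] is injective on [X]. *)
  have : exists f : vertex (P x) -> vertex (P y), cut_embedding f.
    by rewrite -eqP; exists id; split=> // K; exists id.
  by move=> [f]; apply: P_tip.
Qed.
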